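(* Let $N$ be a positive integer, $i\in\{0,1,\ldots,N-1\}$, and let $(a_n)_{n\ge 0}$, $(b_n)_{n\ge0}$ be Jacobi parameters. Suppose that $\lim_{j\to\infty}a_{jN+i-1}=\infty$. Let $\sigma\in\{-1,1\}$, put $$R_n(x)=a_{n+N-1}\big(X_n(x)-\sigma\operatorname{Id}\big),$$ and let $$\Lambda^i=\Big\{x\in\mathbb{R}:\lim_{j\to\infty}\operatorname{discr}R_{jN+i}(x)\text{ exists and is negative}\Big\}.$$ Suppose that $K\subset\Lambda^i$ is a compact interval with non-empty interior such that $$\big(X_{jN+i}:j\in\mathbb{N}\big),\ \big(R_{jN+i}:j\in\mathbb{N}\big)\in\mathcal{D}_1\big(K,\operatorname{GL}(2,\mathbb{R})\big).$$ Then there is a constant $c>1$ such that for every $x\in K$, every generalized eigenvector $(u_n:n\in\mathbb{N}_0)$ associated with $x$, and all $n\ge1$, $$c^{-1}\big(u_0^2+u_1^2\big)\le a_{nN+i-1}\big(u_{nN+i-1}^2+u_{nN+i}^2\big)\le c\,\big(u_0^2+u_1^2\big).$$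
   Context: $\mathbb{N}=\{1,2,\ldots\}$, $\mathbb{N}_0=\mathbb{N}\cup\{0\}$. Jacobi parameters are real sequences $(a_n)_{n\ge0}$, $(b_n)_{n\ge0}$ with $a_n>0$ for all $n$. A (real) sequence $(u_n:n\in\mathbb{N}_0)$ is a generalized eigenvector associated with $x\in\mathbb{R}$ if $x u_n=a_nu_{n+1}+b_nu_n+a_{n-1}u_{n-1}$ for all $n\ge1$ and $(u_0,u_1)\ne(0,0)$. For $n\ge1$ the $1$-step transfer matrix is $B_n(x)=\begin{pmatrix}0&1\\-\frac{a_{n-1}}{a_n}&\frac{x-b_n}{a_n}\end{pmatrix}$, and the $N$-step transfer matrix is $X_n(x)=\prod_{j=n}^{n+N-1}B_j(x)=B_{n+N-1}(x)\cdots B_{n+1}(x)B_n(x)$, so that $(u_{n+N-1},u_{n+N})^T=X_n(x)(u_{n-1},u_n)^T$. For a $2\times2$ matrix $Y$, $\operatorname{discr}Y=(\operatorname{tr}Y)^2-4\det Y$. $\operatorname{GL}(2,\mathbb{R})$ is the set of real invertible $2\times2$ matrices with the spectral norm. For compact $K\subset\mathbb{R}$, a sequence of mappings $Y_n:K\to\operatorname{GL}(2,\mathbb{R})$ belongs to $\mathcal{D}_1(K,\operatorname{GL}(2,\mathbb{R}))$ if $\sum_n\sup_{x\in K}\|Y_{n+1}(x)-Y_n(x)\|<\infty$. *)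

(* Defs.v *)
From HB Require Import structures.
From mathcomp Require Import all_boot all_order all_algebra.
From mathcomp Require Import all_classical all_reals all_analysis.
Set Implicit Arguments.
Unset Strict Implicit.
Unset Printing Implicit Defensive.
Import Order.TTheory GRing.Theory Num.Theory.
Import numFieldNormedType.Exports.
Local Open Scope classical_set_scope.
Local Open Scope ring_scope.

Definition jacobi_parameters (R : realType) (a b : nat -> R) : Prop :=
  forall n, 0 < a n.

Definition generalized_eigenvector (R : realType) (a b : nat -> R) (x : R)
    (u : nat -> R) : Prop :=
  (forall n, (1 <= n)%N ->
     x * u n = a n * u n.+1 + b n * u n + a n.-1 * u n.-1) /\
  (u 0%N, u 1%N) <> (0, 0).

Definition mx22 (R : realType) (p q r s : R) : 'M[R]_2 :=
  \matrix_(i, j) if i == 0 then (if j == 0 then p else q)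
                 else (if j == 0 then r else s).

(* Meaningful for n >= 1; the value at n = 0 (where n.-1 = 0) is junk. *)
Definition transfer (R : realType) (a b : nat -> R) (n : nat) (x : R)
    : 'M[R]_2 :=
  mx22 0 1 (- (a n.-1 / a n)) ((x - b n) / a n).

(* B_{n+N-1}(x) ... B_{n+1}(x) B_n(x): the product is not commutative, and the
   largest index stands on the left. *)
Definition transferN (R : realType) (a b : nat -> R) (N n : nat) (x : R)
    : 'M[R]_2 :=
  \prod_(j <- rev (index_iota n (n + N))) transfer a b j x.

Definition discr (R : realType) (Y : 'M[R]_2) : R :=
  (\tr Y) ^+ 2 - 4 * \det Y.

(* The library norm on matrices is the entrywise maximum, hence the explicit
   Euclidean norm and the operator norm it induces. *)
Definition euclidean_norm (R : realType) (v : 'cV[R]_2) : R :=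
  Num.sqrt (\sum_k (v k 0) ^+ 2).

Definition spectral_norm (R : realType) (Y : 'M[R]_2) : R :=
  sup [set euclidean_norm (Y *m v) | v in [set v | euclidean_norm v = 1]].

(* Sequences are indexed by n >= 1; Y 0 is irrelevant. The sum and the suprema
   are taken in the extended reals, so that < +oo means finiteness. *)
Definition D1_GL2 (R : realType) (K : set R) (Y : nat -> R -> 'M[R]_2)
    : Prop :=
  (forall n x, (1 <= n)%N -> K x -> Y n x \in unitmx) /\
  (\sum_(1 <= n <oo)
     ereal_sup [set (spectral_norm (Y n.+1 x - Y n x))%:E | x in K]
   < +oo)%E.

Definition scaled_transferN (R : realType) (a b : nat -> R) (N : nat)
    (sigma : R) (n : nat) (x : R) : 'M[R]_2 :=
  a (n + N - 1)%N *: (transferN a b N n x - sigma%:M).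

Definition Lambda (R : realType) (a b : nat -> R) (N i : nat) (sigma : R)
    : set R :=
  [set x | exists l : R,
     (fun j => discr (scaled_transferN a b N sigma (j * N + i)%N x))
       @ \oo --> l /\ l < 0].

(* Main.v *)
(* Put w_j = (u_{jN+i-1}, u_{jN+i}) and A_j = a_{jN+i-1}, so that
   w_{j+1} = X_j w_j and det X_j = A_j / A_{j+1}. Since X_j commutes with R_j, the
   Turan determinants S_j = A_j det(w_j, R_j w_j) satisfy the exact identity
   S_{j+1} - S_j = A_{j+1} det(w_{j+1}, (R_{j+1} - R_j) w_{j+1}).
   As discr R_j <= -delta < 0 for large j, uniformly on K, the quadratic form
   det(v, R_j v) is uniformly definite, hence A_j |w_j|^2 is comparable to |S_j|
   and the relative increments of S_j are summable uniformly on K. So S_j is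
   comparable to S_M for all j >= M, and finitely many steps of the recurrence
   lead back to (u_0, u_1). *)
Require Import Defs.
From HB Require Import structures.
From mathcomp Require Import all_boot all_order all_algebra.
From mathcomp Require Import all_classical all_reals all_analysis.
From mathcomp Require Import ring lra.
Set Implicit Arguments.
Unset Strict Implicit.
Unset Printing Implicit Defensive.
Import Order.TTheory GRing.Theory Num.Theory.
Import numFieldNormedType.Exports.
Local Open Scope classical_set_scope.
Local Open Scope ring_scope.

(** * From the spectral norm to entrywise summable increments *)

(** [Y i j] is a coordinate of the image of the unit vector [delta_mx j 0]. *)
Lemma spectral_norm_entry (R : realType) (Y : 'M[R]_2) i j :
  `|Y i j| <= spectral_norm Y.
Proof.
have entry_le (v : 'cV[R]_2) k : `|v k 0| <= euclidean_norm v.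
  rewrite -sqrtr_sqr /euclidean_norm ler_sqrt; last first.
    by apply: sumr_ge0 => l _; exact: sqr_ge0.
  by rewrite (bigD1 k) //= lerDl; apply: sumr_ge0 => l _; exact: sqr_ge0.
set S := [set euclidean_norm (Y *m v) | v in [set v | euclidean_norm v = 1]].
have Sj : S (euclidean_norm (Y *m delta_mx j 0)).
  exists (delta_mx j 0) => //=; rewrite /euclidean_norm (bigD1 j) //= big1.
    by rewrite mxE !eqxx addr0 expr1n sqrtr1.
  by move=> k /negPf kj; rewrite mxE kj expr0n.
(* The supremum is known to dominate its members only once the set is bounded. Coordinates of a unit
   vector have modulus at most 1, so the absolute row sums of [Y] bound the coordinates of the
   image. *)
have hS : has_ubound S.
  exists (Num.sqrt (\sum_k (\sum_l `|Y k l|) ^+ 2)) => _ [v /= v1 <-].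
  rewrite /euclidean_norm ler_sqrt; last first.
    by apply: sumr_ge0 => l _; exact: sqr_ge0.
  apply: ler_sum => k _; rewrite -real_normK ?num_real // lerXn2r ?nnegrE //.
    by apply: sumr_ge0.
  rewrite mxE (le_trans (ler_norm_sum _ _ _)) //; apply: ler_sum => l _.
  by rewrite normrM ler_piMr // -v1 entry_le.
apply: le_trans (ub_le_sup hS Sj).
apply: le_trans (entry_le _ i).
by rewrite -colE mxE.
Qed.

(** Trades the extended-real suprema for a real majorant [rho] with small tails. A point of [K]
    makes the suprema nonnegative. *)
Lemma D1_GL2_increments (R : realType) (K : set R) (Y : nat -> R -> 'M[R]_2) :
  K !=set0 -> D1_GL2 K Y ->
  exists rho : nat -> R,
    [/\ forall n, 0 <= rho n,
        forall n x k l, (1 <= n)%N -> K x ->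
          `|Y n.+1 x k l - Y n x k l| <= rho n &
        forall e, 0 < e -> exists2 M, (1 <= M)%N &
          forall m p, (M <= m)%N -> \sum_(m <= n < p) rho n <= e].
Proof.
move=> [x0 Kx0] [_].
pose r n := ereal_sup [set (spectral_norm (Y n.+1 x - Y n x))%:E | x in K].
rewrite -/(r _) => rfin.
have r_ge n x : K x -> ((spectral_norm (Y n.+1 x - Y n x))%:E <= r n)%E.
  by move=> Kx; apply: ereal_sup_ubound; exists x.
have r0 n : (0 <= r n)%E.
  apply: le_trans (r_ge n _ Kx0); rewrite lee_fin.
  exact: le_trans (spectral_norm_entry _ 0 0).
have rfinite n : (1 <= n)%N -> r n \is a fin_num.
  move=> n1; rewrite ge0_fin_numE //; apply: le_lt_trans rfin.
  apply: le_trans (@nneseries_lim_ge _ r xpredT 1 n.+1 _) => //.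
  by rewrite big_nat_recr //= leeDr // sume_ge0.
exists (fun n => fine (r n)); split.
- by move=> n; rewrite fine_ge0.
- move=> n x k l n1 Kx.
  rewrite -lee_fin fineK ?rfinite //; apply: le_trans (r_ge n _ Kx).
  rewrite lee_fin.
  by have := spectral_norm_entry (Y n.+1 x - Y n x) k l; rewrite !mxE.
- move=> e e0.
  (* The series from 1 does not control [r 0]; with that value replaced by 0 the series from 0 is
     finite and its tails tend to 0. *)
  pose r' n := if n is 0%N then 0%E else r n.
  have r'0 n : (0 <= r' n)%E by case: n => //=.
  have r'sum : (\sum_(0 <= n <oo) r' n < +oo)%E.
    rewrite (@nneseries_split _ _ 0 1) // big_nat1 add0e.
    suff <- : (\sum_(1 <= n <oo) r n = \sum_(1 <= n <oo) r' n)%E by [].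
    by apply: congr_lim; apply/funext => n; apply: eq_big_nat => -[].
  have /fine_cvgP[tailfin /cvgr0Pnorm_lt/(_ _ e0) taile] :=
    nneseries_tail_cvg r'sum (fun k _ => r'0 k).
  have [M [M1 Mfin Me]] : exists M, [/\ (1 <= M)%N,
      (\sum_(M <= n <oo) r' n)%E \is a fin_num &
      `|fine (\sum_(M <= n <oo) r' n)%E| < e].
    near \oo => M; exists M; split; near: M.
    - exact: nbhs_infty_ge.
    - exact: tailfin.
    - exact: taile.
  exists M => // m p Mm.
  have [pm|mp] := leqP p m; first by rewrite big_geq // ltW.
  apply: (@le_trans _ _ (\sum_(M <= n < p) fine (r n))).
    rewrite (big_cat_nat Mm (ltnW mp)) /= lerDr.
    by apply: sumr_ge0 => n _; rewrite fine_ge0.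
  rewrite -lee_fin -sumEFin.
  apply: (@le_trans _ _ (\sum_(M <= n <oo) r' n)%E).
    apply: le_trans (@nneseries_lim_ge _ r' xpredT M p _) => //.
    rewrite big_nat_cond [leRHS]big_nat_cond.
    apply: lee_sum => n /andP[/andP[Mn _] _].
    have n1 := leq_trans M1 Mn.
    by rewrite fineK ?rfinite //; case: n n1 {Mn}.
  by rewrite -(fineK Mfin) lee_fin (le_trans (ler_norm _)) // ltW.
Unshelve. all: by end_near. Qed.

(** * The quadratic form det(v, Y v) and the discriminant *)

Lemma sum_ord2 (V : nmodType) (F : 'I_2 -> V) : \sum_k F k = F 0 + F 1.
Proof.
by rewrite !big_ord_recl big_ord0 addr0; congr (_ + F _); apply: val_inj.
Qed.

Lemma det_mx2 (R : comPzRingType) (Y : 'M[R]_2) :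
  \det Y = Y 0 0 * Y 1 1 - Y 0 1 * Y 1 0.
Proof.
rewrite (expand_det_row _ 0) sum_ord2 /cofactor !det_mx11 !mxE /= mul1r.
rewrite add0n expr1 mulN1r mulrN.
by congr (_ * Y _ _ - _ * Y _ _); apply: val_inj.
Qed.

(** For Y = R_n and v = (u_{n-1}, u_n) the multiple of the identity drops out, leaving a_{n+N-1}
    (u_{n-1} u_{n+N} - u_n u_{n+N-1}), a weighted N-shifted Turan determinant. *)
Definition turan (R : comPzRingType) (Y : 'M[R]_2) (v : 'cV[R]_2) : R :=
  \det (row_mx v (Y *m v)).

Lemma turanE (R : comPzRingType) (Y : 'M[R]_2) (v : 'cV[R]_2) :
  turan Y v = Y 1 0 * v 0 0 ^+ 2 + (Y 1 1 - Y 0 0) * v 0 0 * v 1 0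
              - Y 0 1 * v 1 0 ^+ 2.
Proof.
have El (w : 'cV[R]_2) k : row_mx v w k (0 : 'I_2) = v k 0.
  by rewrite -(row_mxEl v w k 0); congr (row_mx _ _ _ _); apply: val_inj.
have Er (w : 'cV[R]_2) k : row_mx v w k (1 : 'I_2) = w k 0.
  by rewrite -(row_mxEr v w k 0); congr (row_mx _ _ _ _); apply: val_inj.
rewrite /turan det_mx2 !El !Er !mxE !sum_ord2; ring.
Qed.

(** By commutation, the matrix with columns X v and Y X v is X times the matrix with columns v and Y
    v. *)
Lemma turan_mulmx (R : comPzRingType) (X Y : 'M[R]_2) (v : 'cV[R]_2) :
  X *m Y = Y *m X -> turan Y (X *m v) = \det X * turan Y v.
Proof.
by move=> XY; rewrite /turan mulmxA -XY -mulmxA -mul_mx_row det_mulmx.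
Qed.

Lemma turanB (R : comPzRingType) (Y Z : 'M[R]_2) (v : 'cV[R]_2) :
  turan (Y - Z) v = turan Y v - turan Z v.
Proof. rewrite !turanE !mxE; ring. Qed.

Definition sqnorm (R : pzRingType) (v : 'cV[R]_2) : R :=
  v 0 0 ^+ 2 + v 1 0 ^+ 2.

Lemma sqnorm_ge0 (R : realType) (v : 'cV[R]_2) : 0 <= sqnorm v.
Proof. by rewrite addr_ge0 // sqr_ge0. Qed.

(** The square terms of [turanE] give at most B |v|^2; the mixed coefficient is at most 2 B and 2 |x
    y| <= x^2 + y^2, which gives B |v|^2 again. *)
Lemma turan_le (R : realType) (Y : 'M[R]_2) (v : 'cV[R]_2) B :
  (forall k l, `|Y k l| <= B) -> `|turan Y v| <= 2 * B * sqnorm v.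
Proof.
move=> YB; rewrite turanE /sqnorm ler_norml.
move: (YB 0 0) (YB 0 1) (YB 1 0) (YB 1 1); rewrite !ler_norml.
move: (Y 0 0) (Y 0 1) (Y 1 0) (Y 1 1) (v 0 0) (v 1 0) => p q r s x y.
move=> /andP[p1 p2] /andP[q1 q2] /andP[r1 r2] /andP[s1 s2].
have x2 : 0 <= x ^+ 2 by exact: sqr_ge0.
have y2 : 0 <= y ^+ 2 by exact: sqr_ge0.
have hx e : `|e| <= B -> `|e * x ^+ 2| <= B * x ^+ 2.
  by move=> eB; rewrite normrM (ger0_norm x2) ler_wpM2r.
have hy e : `|e| <= B -> `|e * y ^+ 2| <= B * y ^+ 2.
  by move=> eB; rewrite normrM (ger0_norm y2) ler_wpM2r.
have hxy e : `|e| <= B + B -> `|e * x * y| <= B * (x ^+ 2 + y ^+ 2).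
  move=> eB.
  have xy : 2 * `|x * y| <= x ^+ 2 + y ^+ 2.
    rewrite normrM -(real_normK (num_real x)) -(real_normK (num_real y)).
    have := sqr_ge0 (`|x| - `|y|); nra.
  rewrite -mulrA normrM.
  have := ler_wpM2r (normr_ge0 (x * y)) eB.
  have B0 : 0 <= B by lra.
  have := ler_wpM2l B0 xy; lra.
have := hx r; have := hy q; have := hxy (s - p).
rewrite !ler_norml => /(_ ltac:(lra)) /andP[? ?] /(_ ltac:(lra)) /andP[? ?].
move=> /(_ ltac:(lra)) /andP[? ?]; apply/andP; split; lra.
Qed.

(* Completing the square, with r = Y 1 0, t = Y 1 1 - Y 0 0 and v = (x, y):
   4 r turan Y v = (2 r x + t y)^2 - discr Y y^2, and symmetrically for Y 0 1. *)
Lemma turan_ge (R : realType) (Y : 'M[R]_2) (v : 'cV[R]_2) B delta :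
  (forall k l, `|Y k l| <= B) -> discr Y <= - delta ->
  delta * sqnorm v <= 8 * B * `|turan Y v|.
Proof.
move=> YB; rewrite turanE /sqnorm /discr det_mx2 /mxtrace sum_ord2.
move: (YB 0 1) (YB 1 0).
move: (Y 0 0) (Y 0 1) (Y 1 0) (Y 1 1) (v 0 0) (v 1 0) => p q r s x y qB rB hd.
set Q := r * _ + _ - _.
have key e : `|e| <= B -> 4 * e * Q <= 4 * B * `|Q|.
  move=> eB; rewrite -!mulrA ler_pM2l // (le_trans (ler_norm _)) //.
  by rewrite normrM ler_wpM2r.
have hr : delta * y ^+ 2 <= 4 * B * `|Q|.
  apply: le_trans (key r rB).
  have := ler_wpM2r (sqr_ge0 y) hd; have := sqr_ge0 (2 * r * x + (s - p) * y).
  rewrite /Q; lra.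
have hq : delta * x ^+ 2 <= 4 * B * `|Q|.
  have Nq : `|- q| <= B by rewrite normrN.
  apply: le_trans (key _ Nq).
  have := ler_wpM2r (sqr_ge0 x) hd; have := sqr_ge0 (2 * q * y - (s - p) * x).
  rewrite /Q; lra.
lra.
Qed.

Lemma discr_dist (R : realType) (Y Z : 'M[R]_2) B e :
  (forall k l, `|Y k l| <= B) -> (forall k l, `|Z k l| <= B) ->
  (forall k l, `|Y k l - Z k l| <= e) -> `|discr Y - discr Z| <= 16 * B * e.
Proof.
move=> YB ZB YZ; rewrite /discr !det_mx2 /mxtrace !sum_ord2.
have B0 : 0 <= B := le_trans (normr_ge0 _) (YB 0 0).
have e0 : 0 <= e := le_trans (normr_ge0 _) (YZ 0 0).
set p := Y 0 0; set q := Y 0 1; set r := Y 1 0; set s := Y 1 1.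
set p' := Z 0 0; set q' := Z 0 1; set r' := Z 1 0; set s' := Z 1 1.
(* As discr Y = (s - p)^2 + 4 q r, the difference splits into a difference of squares and two
   increments of the product q r; they contribute 8 + 4 + 4 = 16. *)
have -> : (p + s) ^+ 2 - 4 * (p * s - q * r)
          - ((p' + s') ^+ 2 - 4 * (p' * s' - q' * r'))
        = ((s - p) + (s' - p')) * ((s - s') - (p - p'))
          + 4 * (q * (r - r')) + 4 * (r' * (q - q')) by ring.
have h1 : `|((s - p) + (s' - p')) * ((s - s') - (p - p'))| <= 8 * (B * e).
  rewrite normrM (_ : 8 * (B * e) = (4 * B) * (2 * e)); last by ring.
  apply: ler_pM => //.
    move: (YB 0 0) (YB 1 1) (ZB 0 0) (ZB 1 1); rewrite -/p -/s -/p' -/s' !ler_norml.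
    by move=> /andP[? ?] /andP[? ?] /andP[? ?] /andP[? ?]; apply/andP; split; lra.
  move: (YZ 0 0) (YZ 1 1); rewrite -/p -/s -/p' -/s' !ler_norml.
  by move=> /andP[? ?] /andP[? ?]; apply/andP; split; lra.
have h2 : `|q * (r - r')| <= B * e.
  by rewrite normrM; apply: (ler_pM _ _ (YB 0 1) (YZ 1 0)).
have h3 : `|r' * (q - q')| <= B * e.
  by rewrite normrM; apply: (ler_pM _ _ (ZB 1 0) (YZ 0 1)).
move: h1 h2 h3; rewrite !ler_norml.
move=> /andP[? ?] /andP[? ?] /andP[? ?]; apply/andP; split; lra.
Qed.

(** * Sequences with summable increments *)

(* Since 1 - e <= |s_j / s_(j+1)| <= 1 + e, the products telescope, and
   (1 - e)(1 + e) <= 1, prod (1 - e_j) >= 1 - sum e_j give the factor 2. *)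
Lemma small_relative_increments (R : realType) (s e : nat -> R) M :
  (forall j, 0 <= e j) ->
  (forall j, (M <= j)%N -> `|s j.+1 - s j| <= e j * `|s j.+1|) ->
  (forall m, \sum_(M <= j < m) e j <= 2^-1) ->
  forall m, (M <= m)%N -> `|s m| <= 2 * `|s M| /\ `|s M| <= 2 * `|s m|.
Proof.
move=> e0 hs he.
have sum0 m : 0 <= \sum_(M <= j < m) e j by apply: sumr_ge0.
have H m : (M <= m)%N ->
    `|s m| * (1 - \sum_(M <= j < m) e j) <= `|s M| /\
    `|s M| * (1 - \sum_(M <= j < m) e j) <= `|s m|.
  elim: m => [|m IH].
    by rewrite leqn0 => /eqP ->; rewrite big_geq // subr0 mulr1.
  rewrite leq_eqVlt => /orP[/eqP <-|]; first by rewrite big_geq // subr0 mulr1.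
  rewrite ltnS => Mm; have [h1 h2] := IH Mm.
  have := hs _ Mm; have := he m.+1; have := sum0 m; rewrite big_nat_recr //=.
  have := ler_dist_dist (s m.+1) (s m); have := e0 m.
  have := normr_ge0 (s m.+1); have := normr_ge0 (s M).
  move: h1 h2; set S := \sum_(_ <= _ < _) _.
  move: (`|s m.+1|) (`|s m|) (`|s M|) (e m) => x y z f h1 h2 z0 x0 f0 h3 S0 Sf h4.
  have {h3 h4} := le_trans h3 h4; rewrite ler_norml => /andP[h3 h4].
  split.
    have : x * (1 - f) * (1 - S) <= y * (1 - S) by apply: ler_wpM2r; lra.
    have : 0 <= x * (f * S) by rewrite !mulr_ge0.
    lra.
  have : z * (1 - S) * (1 - f) <= y * (1 - f) by apply: ler_wpM2r; lra.
  have : y * (1 - f) <= x * (1 + f) * (1 - f) by apply: ler_wpM2r; lra.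
  have : 0 <= z * (f * S) by rewrite !mulr_ge0.
  have : 0 <= x * (f * f) by rewrite !mulr_ge0.
  lra.
move=> m /H; have := he m; set S := \sum_(_ <= _ < _) _ => hS [h1 h2].
have : 0 <= `|s m| * (2^-1 - S) by rewrite mulr_ge0 // subr_ge0.
have : 0 <= `|s M| * (2^-1 - S) by rewrite mulr_ge0 // subr_ge0.
split; lra.
Qed.

Lemma dist_le_sum (R : realType) (s rho : nat -> R) m n :
  (forall k, (m <= k)%N -> `|s k.+1 - s k| <= rho k) -> (m <= n)%N ->
  `|s n - s m| <= \sum_(m <= k < n) rho k.
Proof.
move=> hs mn; rewrite -telescope_sumr //.
apply: le_trans (ler_norm_sum _ _ _) _; rewrite big_nat_cond [leRHS]big_nat_cond.
by apply: ler_sum => k /andP[/andP[mk _] _]; exact: hs.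
Qed.

(** * Uniformity over a compact set *)

Lemma continuous_compact_le (R : realType) (K : set R) (f : R -> R) :
  compact K -> continuous f -> exists B, forall x, K x -> `|f x| <= B.
Proof.
move=> cK cf.
have /compact_bounded[B [_ hB]] : compact (f @` K).
  by apply: continuous_compact => //; apply: continuous_subspaceT.
by exists (B + 1) => x Kx; apply: hB; [rewrite ltrDl|exists x].
Qed.

Lemma compact_eventually_neg (R : realType) (K : set R) (D : nat -> R -> R) :
  compact K -> (forall n, continuous (D n)) ->
  (forall e, 0 < e -> exists M, forall m n x, (M <= m <= n)%N -> K x ->
     `|D n x - D m x| <= e) ->
  (forall x, K x -> exists l : R, D ^~ x @ \oo --> l /\ l < 0) ->
  exists2 delta, 0 < delta &
    exists M, forall n x, (M <= n)%N -> K x -> D n x <= - delta.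
Proof.
move=> cK cD cauchyD limD.
(* One index n serves both as threshold and, through 1/(n+1), as margin, so the near-covering form
   of compactness along [\oo] yields both uniformly. *)
pose P n x := forall j, (n <= j)%N -> D j x <= - n.+1%:R^-1.
have /near_covering_withinP/(_ nat \oo P _) := (compact_near_coveringP K).1 cK.
case; last first.
  move=> M _ hM; exists M.+1%:R^-1; first by rewrite invr_gt0.
  by exists M => n x Mn Kx; exact: (hM M (leqnn M) x Kx n Mn).
move=> x /limD[l [Dl l0]].
(* Three errors of |l|/4 (limit to [D m x], then to [D m y], then to [D j y]) still leave [D j y] at
   most l/4, which is below -1/(n+1) for large n. *)
have e0 : 0 < - l / 4 by lra.
have [M hM] := cauchyD _ e0.
have [m Mm Dm] : exists2 m, (M <= m)%N & `|l - D m x| < - l / 4.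
  near \oo => m; exists m; near: m; first exact: nbhs_infty_ge.
  by move/cvgrPdist_lt : Dl; exact.
have /cvgrPdist_lt/(_ _ e0) nearx := cD m x.
exists ([set y | `|D m x - D m y| < - l / 4],
        [set n | (m <= n)%N /\ n.+1%:R^-1 < - l / 4]) => /=.
  split => //; near=> n; split; near: n; first exact: nbhs_infty_ge.
  exact: near_infty_natSinv_lt (PosNum e0).
move=> [y n] /= [hy [mn hn]] Ky j nj.
have := hM m j y; rewrite Mm (leq_trans mn nj) => /(_ isT Ky).
move: Dm hy hn; move: (n.+1%:R^-1) => d; rewrite !ltr_norml !ler_norml.
move=> /andP[? ?] /andP[? ?] ? /andP[? ?]; lra.
Unshelve. all: by end_near. Qed.

(** * Transfer matrices acting on generalized eigenvectors *)

Lemma transferNS (R : realType) (a b : nat -> R) N n x :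
  transferN a b N.+1 n x = transfer a b (n + N) x *m transferN a b N n x.
Proof.
rewrite /transferN addnS.
suff -> : index_iota n (n + N).+1 = rcons (index_iota n (n + N)) (n + N)%N.
  by rewrite rev_rcons big_cons.
rewrite /index_iota subSn ?leq_addr // addKn -addn1 iotaD -cats1; congr (_ ++ _).
Qed.

Lemma transferN0 (R : realType) (a b : nat -> R) n x :
  transferN a b 0 n x = 1%:M.
Proof. by rewrite /transferN addn0 /index_iota subnn big_nil. Qed.

Lemma transferN_continuous (R : realType) (a b : nat -> R) N n k l :
  continuous (fun x => transferN a b N n x k l).
Proof.
elim: N k l => [|N IH] k l y.
  under eq_fun do rewrite transferN0; exact: cvg_cst.
under eq_fun do rewrite transferNS mxE sum_ord2.
have cB p q : transfer a b (n + N) x p q @[x --> y] --> transfer a b (n + N) y p q.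
  rewrite mxE; under eq_fun do rewrite mxE.
  case: ifP => _; case: ifP => _; try exact: cvg_cst.
  by apply: cvgM; [apply: cvgB; [exact: cvg_id|exact: cvg_cst]|exact: cvg_cst].
by apply: cvgD; apply: cvgM; [exact: cB|exact: IH|exact: cB|exact: IH].
Qed.

(** Each factor has determinant a_{j-1}/a_j, so the product telescopes. *)
Lemma det_transferN (R : realType) (a b : nat -> R) N n x :
  jacobi_parameters a b -> \det (transferN a b N n.+1 x) = a n / a (n + N)%N.
Proof.
move=> a0; have aN k : a k != 0 by rewrite gt_eqF.
elim: N => [|N IH]; first by rewrite transferN0 det1 addn0 divff.
rewrite transferNS det_mulmx IH addSn addnS det_mx2 !mxE /= mul0r sub0r mul1r opprK.
by rewrite mulrC mulrA mulfVK.
Qed.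

Definition pair_at (R : realType) (u : nat -> R) n : 'cV[R]_2 :=
  \col_k u (n + k)%N.

Lemma sqnorm_pair_at (R : realType) (u : nat -> R) n :
  sqnorm (pair_at u n) = u n ^+ 2 + u n.+1 ^+ 2.
Proof. by rewrite /sqnorm !mxE addn0 addn1. Qed.

Lemma transferN_pair_at (R : realType) (a b u : nat -> R) N n x :
  jacobi_parameters a b -> generalized_eigenvector a b x u ->
  transferN a b N n.+1 x *m pair_at u n = pair_at u (n + N).
Proof.
move=> a0 [hu _]; elim: N => [|N IH]; first by rewrite transferN0 mul1mx addn0.
rewrite transferNS -mulmxA IH; apply/matrixP => k l.
rewrite !mxE sum_ord2 !mxE addn0 addn1 addSn addnS.
have [->|k0] := eqVneq k 0; first by rewrite mul0r add0r mul1r addn0.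
have -> : k = 1 by apply: val_inj; case: k k0 => -[|[|]].
rewrite /= addn1; have := hu (n + N).+1 isT; rewrite /= => hx.
have aN : a (n + N).+1 != 0 by rewrite gt_eqF.
apply: (mulfI aN); rewrite mulrDr !mulrA mulrN mulrCA divff // mulr1.
rewrite [a _ * (_ - _) / _]mulrAC divff // mul1r; lra.
Qed.

(** One step of the recurrence in either direction: [z] is the entry solved for and [al] its
    coefficient. *)
Lemma three_term_le (R : realType) (al be ga y z w T : R) :
  0 < al -> `|be| <= T -> `|ga| <= T -> al * z = be * y + ga * w ->
  y ^+ 2 + z ^+ 2 <= (1 + 2 * (T / al) ^+ 2) * (y ^+ 2 + w ^+ 2).
Proof.
move=> al0 beT gaT alz.
have sq (e : R) : `|e| <= T -> e ^+ 2 <= T ^+ 2.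
  move=> eT; rewrite -(real_normK (num_real e)) lerXn2r ?nnegrE //.
  exact: le_trans eT.
have hz : z ^+ 2 <= 2 * (T / al) ^+ 2 * (y ^+ 2 + w ^+ 2).
  have al2 : 0 < al ^+ 2 by rewrite exprn_gt0.
  rewrite -(ler_pM2l al2) -exprMn alz.
  rewrite (_ : al ^+ 2 * _ = 2 * T ^+ 2 * (y ^+ 2 + w ^+ 2)); last first.
    by field; rewrite gt_eqF.
  have := ler_wpM2r (sqr_ge0 y) (sq _ beT).
  have := ler_wpM2r (sqr_ge0 w) (sq _ gaT).
  have := sqr_ge0 (be * y - ga * w); lra.
have := sqr_ge0 w; lra.
Qed.

(** Induction on [n]: each step, forward or backward, costs a factor uniform in x because
    [x - b n.+1] is bounded on [K]. *)
Lemma eigenvector_initial_range (R : realType) (a b : nat -> R) (K : set R) n :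
  jacobi_parameters a b -> compact K ->
  exists2 C, 0 < C &
    forall x u, K x -> generalized_eigenvector a b x u ->
      sqnorm (pair_at u n) <= C * sqnorm (pair_at u 0) /\
      sqnorm (pair_at u 0) <= C * sqnorm (pair_at u n).
Proof.
move=> a0 cK; elim: n => [|n [C C0 IH]].
  by exists 1 => // x u _ _; rewrite mul1r.
have [B hB] : exists B, forall x, K x -> `|x - b n.+1| <= B.
  by apply: continuous_compact_le => // x; apply: cvgB; [exact: cvg_id|exact: cvg_cst].
pose T := `|B| + a n + a n.+1.
pose f (al : R) := 1 + 2 * (T / al) ^+ 2.
have f1 al : 1 <= f al by rewrite lerDl mulr_ge0 ?sqr_ge0.
have f0 al : 0 < f al := lt_le_trans ltr01 (f1 al).
(* [f (a n.+1)] pays for the forward step and [f (a n)] for the backward one; both are at least 1,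
   so their product serves for both. *)
exists (C * (f (a n) * f (a n.+1))); first by rewrite !mulr_gt0.
move=> x u Kx hu; have [h1 h2] := IH x u Kx hu.
have an := a0 n; have an1 := a0 n.+1.
have rec := hu.1 n.+1 isT; rewrite /= in rec.
have xT : `|x - b n.+1| <= T by have := hB x Kx; have := ler_norm B; rewrite /T; lra.
have anT : `|- a n| <= T by rewrite normrN gtr0_norm // /T; have := normr_ge0 B; lra.
have an1T : `|- a n.+1| <= T by rewrite normrN gtr0_norm // /T; have := normr_ge0 B; lra.
have e1 : a n.+1 * u n.+2 = (x - b n.+1) * u n.+1 + (- a n) * u n by lra.
have e2 : a n * u n = (x - b n.+1) * u n.+1 + (- a n.+1) * u n.+2 by lra.
have s1 : sqnorm (pair_at u n.+1) <= f (a n.+1) * sqnorm (pair_at u n).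
  by have := three_term_le an1 xT anT e1; rewrite !sqnorm_pair_at [u n ^+ 2 + _]addrC.
have s2 : sqnorm (pair_at u n) <= f (a n) * sqnorm (pair_at u n.+1).
  by have := three_term_le an xT an1T e2; rewrite !sqnorm_pair_at [u n ^+ 2 + _]addrC.
split.
  apply: (le_trans s1).
  rewrite [leRHS](_ : _ = f (a n.+1) * (f (a n) * (C * sqnorm (pair_at u 0)))); last first.
    by ring.
  rewrite ler_pM2l //; apply: (le_trans h1).
  by rewrite ler_peMl // mulr_ge0 ?sqnorm_ge0 // ltW.
apply: (le_trans h2); rewrite -!mulrA ler_pM2l //.
apply: (le_trans s2); rewrite ler_pM2l // ler_peMl //; exact: sqnorm_ge0.
Qed.

(** * Uniform Cauchy property, bounds and continuity for the matrix sequences *)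

Lemma D1_GL2_cauchy (R : realType) (K : set R) (Y : nat -> R -> 'M[R]_2) :
  K !=set0 -> D1_GL2 K Y ->
  forall e, 0 < e -> exists2 M, (1 <= M)%N &
    forall m n x k l, (M <= m <= n)%N -> K x ->
      `|Y n x k l - Y m x k l| <= e.
Proof.
move=> K0 /(D1_GL2_increments K0)[rho [_ hY tail]] e e0.
have [M M1 hM] := tail _ e0.
exists M => // m n x k l /andP[Mm mn] Kx.
apply: le_trans (hM m n Mm).
apply: (dist_le_sum (s := fun j => Y j x k l)) => // j mj.
exact: hY (leq_trans M1 (leq_trans Mm mj)) Kx.
Qed.

(** [Y M] is bounded on [K] by continuity, and all later terms stay within 1 of it. *)
Lemma D1_GL2_bounded (R : realType) (K : set R) (Y : nat -> R -> 'M[R]_2) :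
  K !=set0 -> compact K -> (forall n k l, continuous (fun x => Y n x k l)) ->
  D1_GL2 K Y ->
  exists M, exists2 B, 0 < B &
    forall n x k l, (M <= n)%N -> K x -> `|Y n x k l| <= B.
Proof.
move=> K0 cK cY /(D1_GL2_cauchy K0)/(_ 1 ltr01)[M _ hM].
have /choice[f hf] : forall kl : 'I_2 * 'I_2, exists B,
    forall x, K x -> `|Y M x kl.1 kl.2| <= B.
  by move=> kl; exact: continuous_compact_le.
exists M, (1 + \sum_kl `|f kl|) => [|n x k l Mn Kx].
  by rewrite ltr_pwDl // sumr_ge0.
have h1 : `|Y M x k l| <= \sum_kl `|f kl|.
  apply: le_trans (hf (k, l) x Kx) _; rewrite (bigD1 (k, l)) //=.
  by apply: le_trans (ler_norm _) _; rewrite lerDl sumr_ge0.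
have := hM M n x k l; rewrite leqnn Mn => /(_ isT Kx) h2.
rewrite -(subrK (Y M x k l) (Y n x k l)).
by apply: le_trans (ler_normD _ _) _; exact: lerD.
Qed.

Lemma continuous_discr (R : realType) (Y : R -> 'M[R]_2) :
  (forall k l, continuous (fun x => Y x k l)) -> continuous (fun x => discr (Y x)).
Proof.
have discrE (Z : 'M[R]_2) : discr Z =
    (Z 0 0 + Z 1 1) * (Z 0 0 + Z 1 1) - 4 * (Z 0 0 * Z 1 1 - Z 0 1 * Z 1 0).
  by rewrite /discr det_mx2 /mxtrace sum_ord2.
move=> cY x; rewrite (funext (fun y => discrE (Y y))).
have h k l : Y y k l @[y --> x] --> Y x k l by exact: cY.
apply: cvgB; first by apply: cvgM; apply: cvgD; exact: h.
apply: cvgM; first exact: cvg_cst.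
by apply: cvgB; apply: cvgM; exact: h.
Qed.

Lemma scaled_transferN_continuous (R : realType) (a b : nat -> R) N sigma n k l :
  continuous (fun x => scaled_transferN a b N sigma n x k l).
Proof.
move=> x; rewrite /scaled_transferN; under eq_fun do rewrite !mxE.
apply: cvgM; first exact: cvg_cst.
by apply: cvgB; [exact: transferN_continuous|exact: cvg_cst].
Qed.

(** * Weighted Turan determinants and the two-sided estimate *)

(** X_{n+1} commutes with R_{n+1} and has determinant a_n / a_{n+N}, which the weights absorb
    exactly. *)
Lemma turan_transferN (R : realType) (a b u : nat -> R) N sigma n x :
  jacobi_parameters a b -> generalized_eigenvector a b x u ->
  a (n + N)%N * turan (scaled_transferN a b N sigma n.+1 x) (pair_at u (n + N))
  = a n * turan (scaled_transferN a b N sigma n.+1 x) (pair_at u n).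
Proof.
move=> a0 hu; rewrite -(transferN_pair_at _ _ a0 hu) turan_mulmx.
  by rewrite det_transferN // mulrA mulrCA divff ?mulr1 // gt_eqF.
rewrite /scaled_transferN -scalemxAl -scalemxAr mulmxBl mulmxBr.
by rewrite mul_scalar_mx mul_mx_scalar.
Qed.

Theorem theoremA (R : realType) (N i : nat) (hN : (0 < N)%N) (hi : (i < N)%N)
    (a b : nat -> R) (hab : jacobi_parameters a b)
    (ha : (fun j : nat => a (j * N + i - 1)%N) @ \oo --> +oo)
    (sigma : R) (hsigma : sigma = -1 \/ sigma = 1)
    (K : set R) (hKL : K `<=` Lambda a b N i sigma)
    (hKcompact : compact K) (hKinterval : is_interval K)
    (hKint : K° !=set0)
    (hX : D1_GL2 K (fun j x => transferN a b N (j * N + i)%N x))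
    (hR : D1_GL2 K (fun j x => scaled_transferN a b N sigma (j * N + i)%N x)) :
  exists c : R, 1 < c /\
    forall (x : R) (u : nat -> R) (n : nat),
      K x -> generalized_eigenvector a b x u -> (1 <= n)%N ->
      c^-1 * (u 0%N ^+ 2 + u 1%N ^+ 2)
        <= a (n * N + i - 1)%N
           * (u (n * N + i - 1)%N ^+ 2 + u (n * N + i)%N ^+ 2)
      /\ a (n * N + i - 1)%N
           * (u (n * N + i - 1)%N ^+ 2 + u (n * N + i)%N ^+ 2)
        <= c * (u 0%N ^+ 2 + u 1%N ^+ 2).
Proof.
have K0 : K !=set0 by have [x /interior_subset] := hKint; exists x.
(* Index of the first entry of w_j. The subtraction is truncated, so [mS] and [mD] ask for j >= 1,
   which covers i = 0. *)
pose m j := (j * N + i - 1)%N.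
pose Y j x := scaled_transferN a b N sigma (j * N + i)%N x.
have mS j : (1 <= j)%N -> (j * N + i)%N = (m j).+1.
  by move=> j1; rewrite /m subn1 prednK // addn_gt0 muln_gt0 j1 hN.
have mD j : (1 <= j)%N -> m j.+1 = (m j + N)%N.
  by move=> j1; apply: succn_inj; rewrite -mS // mulSn -addnA addnC mS.
have cY j k l : continuous (fun x => Y j x k l).
  exact: scaled_transferN_continuous.
have [rho [rho0 hrho tail]] := D1_GL2_increments K0 hR.
have [M1 [B B0 hB]] := D1_GL2_bounded K0 hKcompact cY hR.
have [delta delta0 [M2 hdelta]] : exists2 delta, 0 < delta &
    exists M, forall n x, (M <= n)%N -> K x -> discr (Y n x) <= - delta.
  apply: (compact_eventually_neg (D := fun n x => discr (Y n x))) => //.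
    by move=> n; exact: continuous_discr (cY n).
  move=> e e0; have [|M _ hM] := D1_GL2_cauchy K0 hR (e := e / (16 * B)).
    by rewrite divr_gt0 // mulr_gt0.
  exists (maxn M1 M) => p q x /andP[]; rewrite geq_max => /andP[M1p Mp] pq Kx.
  rewrite [leRHS](_ : e = 16 * B * (e / (16 * B))); last first.
    by field; rewrite gt_eqF.
  apply: discr_dist => k l; [exact: hB (leq_trans M1p pq) Kx|exact: hB|].
  by apply: hM => //; rewrite Mp.
(* The relative increments will be 16 B / delta * [rho j]; this tail bound makes their sum at most
   1/2. *)
have [|M3 M31 hM3] := tail (delta / (32 * B)).
  by rewrite divr_gt0 // mulr_gt0.
pose M := maxn (maxn M1 M2) M3.
have [M1M M2M M3M] : [/\ (M1 <= M)%N, (M2 <= M)%N & (M3 <= M)%N].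
  by rewrite /M; split; rewrite !leq_max leqnn ?orbT.
pose A j := a (m j).
have A0 j : 0 < A j by exact: hab.
pose q (u : nat -> R) j := sqnorm (pair_at u (m j)).
have q0 u j : 0 <= q u j by exact: sqnorm_ge0.
(* L = 2 * (8 B / delta) * (2 B): the factor 2 from the increments, the lower and the upper bound of
   the form. *)
pose L := 32 * B ^+ 2 / delta.
have L0 : 0 < L by rewrite divr_gt0 // mulr_gt0 // exprn_gt0.
have asymptotic x u n : K x -> generalized_eigenvector a b x u -> (M <= n)%N ->
    A n * q u n <= L * (A M * q u M) /\ A M * q u M <= L * (A n * q u n).
  move=> Kx hu Mn.
  pose s j := A j * turan (Y j x) (pair_at u (m j)).
  have s_le j : (M <= j)%N -> `|s j| <= 2 * B * (A j * q u j).
    move=> Mj; rewrite normrM gtr0_norm // mulrCA ler_pM2l //.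
    by apply: turan_le => k l; exact: hB (leq_trans M1M Mj) Kx.
  have s_ge j : (M <= j)%N -> A j * q u j <= 8 * B / delta * `|s j|.
    move=> Mj; rewrite normrM gtr0_norm // mulrCA ler_pM2l //.
    rewrite mulrAC ler_pdivlMr // mulrC; apply: turan_ge.
      by move=> k l; exact: hB (leq_trans M1M Mj) Kx.
    exact: hdelta (leq_trans M2M Mj) Kx.
  have := @small_relative_increments _ s (fun j => 16 * B / delta * rho j) M.
  case/(_ _ _ _ n Mn) => [j|j Mj|p|sn sM].
  - by rewrite mulr_ge0 // ltW // divr_gt0 // mulr_gt0.
  - have j1 : (1 <= j)%N := leq_trans M31 (leq_trans M3M Mj).
    (* Moving S_j to the vector w_{j+1} leaves only R_{j+1} - R_j in the difference. *)
    have -> : s j = A j.+1 * turan (Y j x) (pair_at u (m j.+1)).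
      by rewrite /s /A mD // /Y mS // turan_transferN.
    have h : A j.+1 * `|turan (Y j.+1 x - Y j x) (pair_at u (m j.+1))|
        <= 2 * rho j * (A j.+1 * q u j.+1).
      rewrite mulrCA ler_pM2l //; apply: turan_le => k l; rewrite !mxE.
      by have := hrho j x k l j1 Kx; rewrite !mxE.
    rewrite -mulrBr -turanB normrM gtr0_norm //; apply: (le_trans h).
    have := ler_wpM2l (mulr_ge0 (ler0n R 2) (rho0 j)) (s_ge j.+1 (leqW Mj)).
    lra.
  - rewrite -mulr_sumr; apply: le_trans (ler_wpM2l _ (hM3 M p M3M)) _.
      by rewrite ltW // divr_gt0 // mulr_gt0.
    rewrite [leLHS](_ : _ = 2^-1) //; field.
    by rewrite !gt_eqF.
  have hk : 0 <= 8 * B / delta by rewrite ltW // divr_gt0 // mulr_gt0.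
  have {}sn := ler_wpM2l hk sn; have {}sM := ler_wpM2l hk sM.
  have hM := ler_wpM2l hk (s_le M (leqnn M)).
  have hn := ler_wpM2l hk (s_le n Mn).
  have gM := s_ge M (leqnn M); have gn := s_ge n Mn.
  have -> : L = 2 * (8 * B / delta * (2 * B)).
    by rewrite /L; field; rewrite gt_eqF.
  split; lra.
have /choice[C hC] : forall n, exists C, 0 < C /\
    forall x u, K x -> generalized_eigenvector a b x u ->
      A n * q u n <= C * sqnorm (pair_at u 0) /\
      sqnorm (pair_at u 0) <= C * (A n * q u n).
  move=> n; have [C C0 hC] := eigenvector_initial_range (m n) hab hKcompact.
  (* [A n] serves the upper bound, its inverse the lower one. *)
  exists (C * (A n + (A n)^-1)).
  have AV0 : 0 < (A n)^-1 by rewrite invr_gt0.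
  split=> [|x u Kx hu]; first by rewrite mulr_gt0 // addr_gt0.
  have [h1 h2] := hC x u Kx hu; split.
    apply: (@le_trans _ _ (A n * (C * sqnorm (pair_at u 0)))).
      by rewrite ler_pM2l.
    rewrite mulrA [A n * C]mulrC ler_wpM2r ?sqnorm_ge0 // ler_pM2l //.
    by rewrite lerDl ltW.
  apply: (le_trans h2); rewrite -mulrA ler_pM2l // mulrDl mulKf ?gt_eqF //.
  by rewrite lerDr mulr_ge0 // ?mulr_ge0 // ltW.
(* Dominates the finitely many constants for indices up to [M], and exceeds 1. *)
pose C' := 1 + \sum_(n < M.+1) C n.
have C0 n : 0 < C n by have [] := hC n.
have CC' n : (n <= M)%N -> C n <= C'.
  rewrite -ltnS => nM; rewrite /C' (bigD1 (Ordinal nM)) //= addrCA lerDl.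
  by rewrite addr_ge0 // sumr_ge0 // => k _; exact: ltW.
have C'1 : 1 < C'.
  by rewrite /C' ltrDl big_ord_recl ltr_pwDl // sumr_ge0 // => k _; exact: ltW.
have C'0 : 0 < C' := lt_trans ltr01 C'1.
(* For n <= M the factor [C'] suffices; beyond, the comparison with index [M] costs a further
   [L]. *)
exists (C' * (L + 1)); split=> [|x u n Kx hu n1].
  apply: (lt_le_trans C'1); rewrite ler_peMr //; first exact: ltW.
  by rewrite lerDr ltW.
suff [h1 h2] : A n * q u n <= C' * (L + 1) * sqnorm (pair_at u 0) /\
    sqnorm (pair_at u 0) <= C' * (L + 1) * (A n * q u n).
  move: h1 h2; rewrite /q !sqnorm_pair_at -mS // => h1 h2.
  by rewrite ler_pdivrMl // mulr_gt0 // addr_gt0.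
have E0 : 0 <= sqnorm (pair_at u 0) by exact: sqnorm_ge0.
have F0 : 0 <= A n * q u n by rewrite mulr_ge0 // ltW.
have initial j : (j <= M)%N -> A j * q u j <= C' * sqnorm (pair_at u 0) /\
    sqnorm (pair_at u 0) <= C' * (A j * q u j).
  move=> jM; have [_ /(_ x u Kx hu)[h1 h2]] := hC j.
  by split; [apply: (le_trans h1)|apply: (le_trans h2)];
    rewrite ler_wpM2r ?CC' // mulr_ge0 // ltW.
have CE0 := mulr_ge0 (ltW C'0) E0; have CF0 := mulr_ge0 (ltW C'0) F0.
have [nM|/ltnW Mn] := leqP n M.
  have [h1 h2] := initial n nM.
  have := mulr_ge0 (ltW L0) CE0; have := mulr_ge0 (ltW L0) CF0; split; lra.
have [h1 h2] := asymptotic x u n Kx hu Mn; have [h3 h4] := initial M (leqnn M).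
have := ler_wpM2l (ltW L0) h3; have := ler_wpM2l (ltW C'0) h2; split; lra.
Qed.
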